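(* Let $n \in \mathbb{N}$, let $\tau$ be a truncated addition table over $n$ elements, and let $\mathcal{P}_\tau \subseteq \mathbb{R}^n$ be its SR-polytope. Then for every positive $f \in \mathbb{N}$, the map $$(x_1, \ldots, x_n) \mapsto \{0\} \cup \{x_1, \ldots, x_n\} \cup \{m \in \mathbb{N} : m \geq f+1\}$$ is a one-to-one correspondence between the integer lattice points in the dilate $f\mathcal{P}_\tau$ (that is, $f\mathcal{P}_\tau \cap \mathbb{Z}^n$) and the numerical semigroups with Frobenius number $f$ whose positive sporadic elements have addition table $\tau$ (that is, which have exactly $n$ positive sporadic elements and whose sporadic addition table is $\tau$).
   Context: $\mathbb{N} = \{0,1,2,\ldots\}$ and $[n] = \{1,\ldots,n\}$. A numerical semigroup is a subset $S \subseteq \mathbb{N}$ with finite complement in $\mathbb{N}$ that contains $0$ and is closed under addition. The elements of $\mathbb{N}\setminus S$ are the gaps of $S$; the largest gap is the Frobenius number of $S$; the elements of $S$ less than its Frobenius number are the sporadic elements of $S$. A truncated addition table (or addition table) over $n$ elements is a function $\tau : [n]^2 \to [n] \cup \{\infty\}$. If $S$ is a numerical semigroup with Frobenius number $f$ and positive sporadic elements $x_1 < \cdots < x_n < f$, the sporadic addition table of $S$ is the addition table $\tau$ over $n$ elements defined by $\tau(i,j) = k$ if $x_i + x_j = x_k$, and $\tau(i,j) = \infty$ if $x_i + x_j > f$. For an addition table $\tau$ over $n$ elements, the sporadic relation polytope (SR-polytope) $\mathcal{P}_\tau \subseteq \mathbb{R}^n$ is the set of $(x_1,\ldots,x_n)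 \in \mathbb{R}^n$ satisfying: (order inequalities) $0 < x_1 < \cdots < x_n < 1$; (sporadic relations) $x_i + x_j = x_k$ whenever $\tau(i,j) = k < \infty$; (truncation inequalities) $x_i + x_j > 1$ whenever $\tau(i,j) = \infty$. The set $\mathcal{P}_\tau$ may be empty. The dilate is $f\mathcal{P}_\tau = \{f x : x \in \mathcal{P}_\tau\}$. *)

(* Defs.v *)
From mathcomp Require Import all_boot all_order all_algebra.
From mathcomp Require Import all_classical reals.

Set Implicit Arguments.
Unset Strict Implicit.
Unset Printing Implicit Defensive.

Import Order.TTheory GRing.Theory Num.Theory.

Local Open Scope classical_set_scope.

Record numerical_semigroup (S : set nat) : Prop := NumericalSemigroup {
  numsgp_cofinite : finite_set (~` S);
  numsgp0 : S 0;
  numsgpD : forall a b : nat, S a -> S b -> S (a + b)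
}.

Definition frobenius_number (S : set nat) (f : nat) : Prop :=
  (~` S) f /\ forall g : nat, (~` S) g -> g <= f.

(* To be used when f is the Frobenius number of S. *)
Definition pos_sporadic (S : set nat) (f : nat) : set nat :=
  [set s | [/\ S s, 0 < s & s < f]].

(* The index set [n] is 'I_n, shifted to start at 0; None stands for infinity. *)
Definition addition_table (n : nat) : Type := 'I_n -> 'I_n -> option 'I_n.

(* To be used when f is the Frobenius number of the numerical semigroup S.
   The increasing enumeration x of the positive sporadic elements is unique if
   it exists, and it exists iff S has exactly n of them. The two cases defining
   tau i j are exhaustive and mutually exclusive, because f is a gap of S. *)
Definition has_sporadic_table (n : nat) (S : set nat) (f : nat)
    (tau : addition_table n) : Prop :=
  exists x : 'I_n -> nat,
    [/\ forall i j : 'I_n, i < j -> x i < x j,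
        range x = pos_sporadic S f &
        forall i j : 'I_n,
          (forall k : 'I_n, x i + x j = x k -> tau i j = Some k) /\
          (f < x i + x j -> tau i j = None)].

Local Open Scope ring_scope.

(* The chain 0 < x_1 < ... < x_n < 1 is split so that it also covers n = 0. *)
Definition sr_polytope (R : realType) (n : nat) (tau : addition_table n) :
    set 'rV[R]_n :=
  [set x : 'rV[R]_n |
           [/\ forall i : 'I_n, 0 < x ord0 i < 1,
               forall i j : 'I_n, (i < j)%N -> x ord0 i < x ord0 j,
               forall i j k : 'I_n,
                 tau i j = Some k -> x ord0 i + x ord0 j = x ord0 k &
               forall i j : 'I_n,
                 tau i j = None -> 1 < x ord0 i + x ord0 j]].

Definition dilate (R : realType) (n : nat) (c : R) (P : set 'rV[R]_n) :
    set 'rV[R]_n :=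
  [set c *: x | x in P].

Definition lattice_points (R : realType) (n : nat) : set 'rV[R]_n :=
  [set x : 'rV[R]_n | forall i : 'I_n, x ord0 i \is a Num.int].

(* Coordinates are compared with naturals inside R. Lattice points of a
   dilated SR-polytope have positive integer coordinates, so none is lost. *)
Definition semigroup_of_point (R : realType) (n f : nat) (x : 'rV[R]_n) :
    set nat :=
  [set 0%N] `|` [set m | exists i : 'I_n, m%:R = x ord0 i]
            `|` [set m | (f + 1 <= m)%N].

(* Main.v *)
Require Import Defs.
From mathcomp Require Import all_boot all_order all_algebra.
From mathcomp Require Import all_classical reals.
From mathcomp Require Import zify.

(** Clearing denominators turns a lattice point of the dilate by [f] into a
    map [a] to the naturals that solves the defining system of the polytope
    with the bound 1 replaced by [f] ([lattice_pointP]); such a map is called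
    a realization of the table.

    A realization [a] gives a semigroup because a sum [a i + a j] is either
    another value [a k], or larger than [f]; as all values are smaller than
    [f], these two outcomes exclude each other, so the table that is read off
    the semigroup is the given one
    ([semigroup_of_realization]).

    In the other direction, let [a] enumerate the positive sporadic elements of
    a semigroup with Frobenius number [f]. A sum [a i + a j] lies in the
    semigroup, so it is not the gap [f]: it is sporadic or exceeds [f].
    Hence the table decides which of the two happens, and [a] is a realization
    ([realization_of_table]).

    The correspondence is injective because the values of [a] are the positive
    sporadic elements of the semigroup, and a finite set of naturals has just
    one increasing enumeration ([increasing_enum_unique]). *)

Import Order.TTheory GRing.Theory Num.Theory.

Local Open Scope classical_set_scope.
Local Open Scope ring_scope.

(** The integer solutions of the system that cuts out the dilate by [f] of the
    polytope, stated without reference to the reals. *)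
Definition realization {n : nat} (tau : addition_table n) (f : nat)
    (a : 'I_n -> nat) : Prop :=
  [/\ forall i, (0 < a i < f)%N,
      forall i j : 'I_n, (i < j)%N -> (a i < a j)%N,
      forall i j k, tau i j = Some k -> (a i + a j = a k)%N &
      forall i j, tau i j = None -> (f < a i + a j)%N].

Definition truncated_semigroup {n : nat} (f : nat) (a : 'I_n -> nat) : set nat :=
  [set 0%N] `|` range a `|` [set m | (f < m)%N].

Definition row_of_nats (R : realType) {n : nat} (a : 'I_n -> nat) : 'rV[R]_n :=
  \row_i (a i)%:R.

Lemma increasing_inj (n : nat) (a : 'I_n -> nat) :
  (forall i j : 'I_n, (i < j)%N -> (a i < a j)%N) -> injective a.
Proof.
move=> a_incr i j aij; apply: val_inj => /=.
by case: (ltngtP i j) => // /a_incr; rewrite aij ltnn.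
Qed.

(** The values of an increasing map, listed in order of the index, form a
    strictly sorted list, and such a list is determined by its set of
    entries. *)
Lemma increasing_enum_unique (n : nat) (a b : 'I_n -> nat) :
  (forall i j : 'I_n, (i < j)%N -> (a i < a j)%N) ->
  (forall i j : 'I_n, (i < j)%N -> (b i < b j)%N) ->
  range a = range b -> a = b.
Proof.
have sorted_codom (c : 'I_n -> nat) :
    (forall i j : 'I_n, (i < j)%N -> (c i < c j)%N) -> sorted ltn (codom c).
  move=> c_incr; apply: (homo_sorted (e := relpre val ltn)) => //.
  by rewrite -sorted_map val_enum_ord iota_ltn_sorted.
move=> a_incr b_incr range_ab.
have codom_ab : codom a = codom b.
  apply: (irr_sorted_eq ltn_trans ltnn); [exact: sorted_codom..|].
  move=> m; apply/codomP/codomP => -[i ->].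
    have [j _ <-] : range b (a i) by rewrite -range_ab; exists i.
    by exists j.
  have [j _ <-] : range a (b i) by rewrite range_ab; exists i.
  by exists j.
apply/funext => i; have /eq_in_map := codom_ab; apply.
by rewrite mem_enum.
Qed.

(** The coordinates of a lattice point are positive integers, so they are images
    of naturals; dividing the system by [f], or multiplying it by [f], is then
    compatible with every condition because [f] is positive. *)
Lemma lattice_pointP (R : realType) (n : nat) (tau : addition_table n)
    (f : nat) (x : 'rV[R]_n) : (0 < f)%N ->
  (dilate f%:R (@sr_polytope R n tau) `&` @lattice_points R n) x <->
  exists2 a, realization tau f a & x = row_of_nats R a.
Proof.
move=> f_gt0; have f_gt0R : 0 < f%:R :> R by rewrite ltr0n.
split=> [[[y [y01 y_incr y_some y_none] <-] y_int]|[a [a0f a_incr a_some a_none] ->]].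
  pose a i := Num.trunc ((f%:R *: y) ord0 i).
  have aE i : (a i)%:R = f%:R * y ord0 i.
    have /andP[y_gt0 _] := y01 i.
    have := y_int i; rewrite /a mxE => fy_int; apply: truncnK.
    by rewrite natrEint fy_int mulr_ge0 // ltW.
  exists a; last by apply/rowP => i; rewrite !mxE aE.
  split=> [i|i j /y_incr yij|i j k /y_some yijk|i j /y_none yij].
  - by rewrite -(ltr0n R) -(ltr_nat R) aE pmulr_rgt0 // gtr_pMr // y01.
  - by rewrite -(ltr_nat R) !aE ltr_pM2l.
  - by apply/eqP; rewrite -(eqr_nat R) natrD !aE -mulrDr yijk.
  - by rewrite -(ltr_nat R) natrD !aE -mulrDr ltr_pMr.
split; last by move=> i; rewrite mxE natr_int.
exists (f%:R^-1 *: row_of_nats R a); last first.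
  by rewrite scalerA divff ?scale1r // gt_eqF.
split=> [i|i j /a_incr aij|i j k /a_some aijk|i j /a_none aij]; rewrite !mxE.
- have /andP[a_gt0 a_ltf] := a0f i.
  by rewrite mulr_gt0 ?invr_gt0 ?ltr0n //= ltr_pdivrMl // mulr1 ltr_nat.
- by rewrite ltr_pM2l ?invr_gt0 // ltr_nat.
- by rewrite -mulrDr -natrD aijk.
- by rewrite -mulrDr -natrD ltr_pdivlMl // mulr1 ltr_nat.
Qed.

Lemma semigroup_of_row (R : realType) (n f : nat) (a : 'I_n -> nat) :
  semigroup_of_point f (row_of_nats R a) = truncated_semigroup f a.
Proof.
rewrite /semigroup_of_point /truncated_semigroup; congr (_ `|` _ `|` _).
  apply/seteqP; split=> m [i].
    by rewrite mxE => /eqP; rewrite eqr_nat => /eqP ->; exists i.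
  by move=> _ <-; exists i; rewrite mxE.
by apply/seteqP; split=> m /=; rewrite addn1.
Qed.

Lemma pos_sporadic_truncated (n f : nat) (a : 'I_n -> nat) :
  (forall i, (0 < a i < f)%N) -> pos_sporadic (truncated_semigroup f a) f = range a.
Proof.
move=> a0f; apply/seteqP; split=> m.
  by move=> [[[->|]|/= fm] m_gt0 m_ltf] //; lia.
move=> [i _ <-]; have /andP[a_gt0 a_ltf] := a0f i.
by split=> //; left; right; exists i.
Qed.

(** Closure under addition uses only that each finite entry of the table records
    a true sum and each infinite entry a sum above [f]. Reading the table back
    uses the bound [a k < f], which keeps the two cases apart, and the
    injectivity of [a], which makes the index of a sum unique. *)
Lemma semigroup_of_realization (n f : nat) (tau : addition_table n)
    (a : 'I_n -> nat) : (0 < f)%N -> realization tau f a ->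
  [/\ numerical_semigroup (truncated_semigroup f a),
      frobenius_number (truncated_semigroup f a) f &
      has_sporadic_table (truncated_semigroup f a) f tau].
Proof.
move=> f_gt0 [a0f a_incr a_some a_none]; split.
- split.
  + apply: (sub_finite_set _ (finite_II f.+1)) => m /= Sm.
    by rewrite ltnS leqNgt; apply/negP => fm; apply: Sm; right.
  + by left; left.
  + move=> b c [[->|[i _ <-]]|/= fb]; first by rewrite add0n.
      move=> [[->|[j _ <-]]|/= fc].
      * by rewrite addn0; left; right; exists i.
      * case tauij : (tau i j) => [k|]; last by right; apply: a_none.
        by left; right; exists k => //; rewrite (a_some _ _ _ tauij).
      * by right=> /=; lia.
    by move=> _; right=> /=; lia.
- split=> [[[f0|[i _ aif]]|/=]|g Sg].
  + by rewrite f0 in f_gt0.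
  + by have := a0f i; rewrite aif ltnn andbF.
  + by rewrite ltnn.
  + by rewrite leqNgt; apply/negP => fg; apply: Sg; right.
- exists a; split=> [//||i j]; first by rewrite pos_sporadic_truncated.
  split=> [k aijk|f_lt]; case tauij : (tau i j) => [l|] //.
  + have := a_some _ _ _ tauij; rewrite aijk => /(increasing_inj _ _ a_incr).
    by move=> ->.
  + by have := a_none _ _ tauij; have := a0f k; lia.
  + by have := a_some _ _ _ tauij; have := a0f l; lia.
Qed.

(** The key is the dichotomy [sumP]: the sum of two sporadic elements is either
    sporadic or above [f], since it belongs to the semigroup and hence cannot
    equal the gap [f]. This turns the description of the table from the sums,
    which is what the sporadic table provides, into a description of the sums
    from the table, which is what a realization requires. *)
Lemma realization_of_table (n f : nat) (tau : addition_table n) (S : set nat) :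
  numerical_semigroup S -> frobenius_number S f -> has_sporadic_table S f tau ->
  exists2 a, realization tau f a & truncated_semigroup f a = S.
Proof.
move=> [_ S0 SD] [Sf gap_le] [a [a_incr range_a tauP]].
have aP i : pos_sporadic S f (a i) by rewrite -range_a; exists i.
have sporadicP m : S m -> (0 < m < f)%N -> exists i, a i = m.
  move=> Sm /andP[m_gt0 m_ltf].
  have [i _ <-] : range a m by rewrite range_a.
  by exists i.
have S_neqf m : S m -> m <> f by move=> Sm mf; apply: Sf; rewrite -mf.
have sumP i j : (exists k, (a i + a j = a k)%N) \/ (f < a i + a j)%N.
  have [Sai ai_gt0 _] := aP i; have [Saj _ _] := aP j.
  have Sij := SD _ _ Sai Saj.
  case: (ltngtP (a i + a j)%N f) => [ij_ltf|f_lt|/(S_neqf _ Sij)//].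
    2: by right.
  have [|k ak] := sporadicP _ Sij; first by lia.
  by left; exists k.
exists a.
  split=> // [i|i j k tauij|i j tauij].
  - by have [_ -> ->] := aP i.
  - have [tau_some tau_none] := tauP i j.
    case: (sumP i j) => [[l aijl]|/tau_none]; last by rewrite tauij.
    by have := tau_some _ aijl; rewrite tauij => -[->].
  - have [tau_some _] := tauP i j.
    by case: (sumP i j) => // -[l /tau_some]; rewrite tauij.
apply/seteqP; split=> m.
  move=> [[->|[i _ <-]]|/= fm] //; first by have [] := aP i.
  by apply: contrapT => /gap_le; rewrite leqNgt fm.
move=> Sm; case: (posnP m) => [->|m_gt0]; first by left; left.
case: (ltngtP m f) => [m_ltf|fm|/(S_neqf _ Sm)//]; last by right.
have [|i <-] := sporadicP _ Sm; first by rewrite m_gt0.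
by left; right; exists i.
Qed.

Theorem theorem1 (R : realType) (n : nat) (tau : addition_table n)
    (f : nat) (hf : (0 < f)%N) :
  set_bij (dilate f%:R (@sr_polytope R n tau) `&` @lattice_points R n)
          [set S : set nat | [/\ numerical_semigroup S,
                                 frobenius_number S f &
                                 has_sporadic_table S f tau]]
          (@semigroup_of_point R n f).
Proof.
split.
- move=> x /(lattice_pointP _ _ _ _ _ hf)[a a_real ->] /=.
  by rewrite semigroup_of_row; apply: semigroup_of_realization.
- move=> x y; rewrite !inE.
  move=> /(lattice_pointP _ _ _ _ _ hf)[a [a0f a_incr _ _] ->].
  move=> /(lattice_pointP _ _ _ _ _ hf)[b [b0f b_incr _ _] ->].
  rewrite !semigroup_of_row => Sab; congr (row_of_nats R _).
  apply: increasing_enum_unique => //.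
  by rewrite -(pos_sporadic_truncated _ _ _ a0f) Sab pos_sporadic_truncated.
- move=> S [S_sgp S_frob S_table].
  have [a a_real <-] := realization_of_table _ _ _ _ S_sgp S_frob S_table.
  exists (row_of_nats R a); last exact: semigroup_of_row.
  by apply/(lattice_pointP _ _ _ _ _ hf); exists a.
Qed.
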